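(* Let $n$ be a positive integer. The operator $R_{\mathfrak p}$ on $V_n\otimes V_n$ (which depends polynomially on $h$) is of the form $I+r_{\mathfrak p}h+O(h^2)$, where for $0\le i,j\le n-1$ $$r_{\mathfrak p}\cdot z_1^iz_2^j=n\sum_k\eta(i,j,k)\,z_1^kz_2^{i+j-k-1}+i\,z_1^{i-1}z_2^j-j\,z_1^iz_2^{j-1}.$$ In particular, with respect to the basis $e_i=z^{i-1}$ $(1\le i\le n)$ of $V_n$, the matrix representation of $r_{\mathfrak p}$ is $$r_{\mathfrak p}=n\sum_{1\le i<j\le n}\ \sum_{k=i}^{j-1}E_{k,i}\wedge E_{i+j-k-1,j}+\sum_{i,j=1}^n(j-1)\,E_{j-1,j}\wedge E_{i,i}.$$
   Context: $\mathbb{F}$ is an algebraically closed field of characteristic zero. $V_n$ is the space of polynomials in one variable $z$ over $\mathbb{F}$ of degree less than $n$, and $V_n\otimes V_n$ is identified with the space of polynomials in $z_1,z_2$ of degree less than $n$ in each variable (first factor in $z_1$, second in $z_2$). $R_{\mathfrak p}$ is the restriction to $V_n\otimes V_n$ of the operator $$\tilde F_h-\frac{hn}{z_1-z_2+h}(\tilde F_h-P),$$ where $(\tilde F_hf)(z_1,z_2)=f(z_1+h,z_2-h)$ and $(Pf)(z_1,z_2)=f(z_2,z_1)$; this operator preserves $V_n\otimes V_n$. The function $\eta$ is $$\eta(i,j,k)=\begin{cases}1&\text{if }i\le k<j\\-1&\text{if }j\le k<i\\0&\text{otherwise.}\end{cases}$$ $E_{ij}\in\operatorname{End}V_n$ is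 the matrix unit with $E_{ij}e_k=\delta_{jk}e_i$ (terms with coefficient $j-1=0$ are $0$), and $x\wedge y=x\otimes y-y\otimes x$. Terms in which the coefficient $i$, $j$ or $\eta$ is zero are understood to be zero. *)

(* Defs.v *)
From HB Require Import structures.
From mathcomp Require Import all_boot all_order all_algebra ring.
From mathcomp Require Export mxtens.

Set Implicit Arguments.
Unset Strict Implicit.
Unset Printing Implicit Defensive.

Import GRing.Theory.
Local Open Scope ring_scope.

(* Polynomials in z1, z2 are elements of {poly {poly F}}, with z1 the outer
   variable and z2 the variable of the coefficients (as in polyXY). *)
Local Notation z1 := ('X : {poly {poly _}}).
Local Notation z2 := ('X%:P : {poly {poly _}}).

Section BoundedBidegree.
Variables (F : fieldType) (n : nat).
Implicit Types (f g : {poly {poly F}}) (c : F).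

Definition bidegree_lt : {pred {poly {poly F}}} :=
  fun f => (size f <= n)%N && (sizeY f <= n)%N.

Lemma bidegree_ltP f :
  reflect (forall i j, (n <= i)%N || (n <= j)%N -> f`_i`_j = 0)
          (f \in bidegree_lt).
Proof.
apply: (iffP andP) => [[sX sY] i j /orP[ni|nj] | f0].
- by rewrite [f`_i]nth_default ?coef0 // (leq_trans sX ni).
- by apply/nth_default/(leq_trans _ nj)/(leq_trans _ sY)/max_size_coefXY.
split.
  by apply/leq_sizeP => i ni; apply/polyP => j; rewrite coef0 f0 ?ni.
apply/bigmax_leqP => i _; apply/leq_sizeP => j nj.
by rewrite f0 ?nj ?orbT.
Qed.

Fact bidegree_lt_zmod_closed : zmod_closed bidegree_lt.
Proof.
split=> [|f g /bidegree_ltP f0 /bidegree_ltP g0]; apply/bidegree_ltP => i j ij.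
  by rewrite !coef0.
by rewrite !coefB f0 // g0 // subrr.
Qed.
HB.instance Definition _ :=
  GRing.isZmodClosed.Build {poly {poly F}} bidegree_lt bidegree_lt_zmod_closed.

(* The space V_n (x) V_n, as polynomials in z1, z2. *)
Record tensV := TensV { tpoly :> {poly {poly F}}; _ : tpoly \in bidegree_lt }.

HB.instance Definition _ := [isSub for tpoly].
HB.instance Definition _ := [Choice of tensV by <:].
HB.instance Definition _ := [SubChoice_isSubZmodule of tensV by <:].

Fact tensV_scale_subproof c (v : tensV) : c%:P *: tpoly v \in bidegree_lt.
Proof.
case: v => f /= /bidegree_ltP f0; apply/bidegree_ltP => i j ij.
by rewrite coefZ coefCM f0 // mulr0.
Qed.
Definition tensV_scale c (v : tensV) : tensV :=
  TensV (tensV_scale_subproof c v).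

Fact tensV_scalerA a b v :
  tensV_scale a (tensV_scale b v) = tensV_scale (a * b) v.
Proof. by apply: val_inj; rewrite /= scalerA polyCM. Qed.
Fact tensV_scale1r : left_id 1 tensV_scale.
Proof. by move=> v; apply: val_inj; rewrite /= scale1r. Qed.
Fact tensV_scalerDr : right_distributive tensV_scale +%R.
Proof. by move=> c u v; apply: val_inj; rewrite /= scalerDr. Qed.
Fact tensV_scalerDl v : {morph tensV_scale^~ v : a b / a + b}.
Proof. by move=> a b; apply: val_inj; rewrite /= polyCD scalerDl. Qed.
HB.instance Definition _ := GRing.Zmodule_isLmodule.Build F tensV
  tensV_scalerA tensV_scale1r tensV_scalerDr tensV_scalerDl.

Fact tensV_vect_iso : Vector.axiom (n * n) tensV.
Proof.
pose toM (v : tensV) : 'M[F]_n := \matrix_(i, j) (tpoly v)`_i`_j.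
have ofM_subproof (A : 'M[F]_n) :
    \poly_(i < n) \poly_(j < n)
      (if insub i is Some a then if insub j is Some b then A a b else 0 else 0)
      \in bidegree_lt.
  apply/bidegree_ltP => i j /orP[ni|nj]; rewrite coef_poly.
    by rewrite ltnNge ni coef0.
  by case: ifP => _; rewrite ?coef0 // coef_poly ltnNge nj.
exists (fun v => mxvec (toM v)).
  move=> c u v; rewrite -linearP; congr mxvec; apply/matrixP => i j.
  by rewrite !mxE /= coefD coefZ coefD coefCM.
exists (fun w => TensV (ofM_subproof (vec_mx w))) => [v|w].
  apply: val_inj; rewrite /= mxvecK; apply/polyP => i; apply/polyP => j.
  have /bidegree_ltP v0 := valP v.
  rewrite coef_poly; case: ltnP => ni; last by rewrite coef0 v0 ?ni.
  rewrite coef_poly; case: ltnP => nj; last by rewrite v0 ?nj ?orbT.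
  by rewrite !insubT mxE.
rewrite -[RHS]vec_mxK; congr mxvec; apply/matrixP => i j.
rewrite mxE /= coef_poly ltn_ord coef_poly ltn_ord.
by rewrite !valK.
Qed.
HB.instance Definition _ := Lmodule_hasFinDim.Build F tensV tensV_vect_iso.

End BoundedBidegree.

Fact Rp_linear_subproof (K : fieldType) (k c a b a' b' : K) :
  (c * a + a') - k * ((c * a + a') - (c * b + b')) =
  c * (a - k * (a - b)) + (a' - k * (a' - b')).
Proof. by ring. Qed.

Section OperatorR.
Variables (F : fieldType) (n : nat) (h : F).
Implicit Types f g : {poly {poly F}}.

(* f(z1 + h, z2 - h) *)
Definition Fshift f : {poly {poly F}} :=
  map_poly (comp_poly ('X - h%:P)) f \Po ('X + h%:P%:P).

(* The operator with values in F(z1, z2); (P f)(z1, z2) = f(z2, z1) is swapXY. *)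
Definition Rp_frac f : {fraction {poly {poly F}}} :=
  tofrac (Fshift f) -
  tofrac (h%:P%:P *+ n) / tofrac (z1 - z2 + h%:P%:P) *
    (tofrac (Fshift f) - tofrac (swapXY f)).

Lemma FshiftE f N : (size f <= N)%N ->
  Fshift f =
  \sum_(i < N) (f`_i \Po ('X - h%:P))%:P * (('X + h%:P) ^+ i)^:P.
Proof.
move=> sN; have sM : (size (map_poly (comp_poly ('X - h%:P)) f) <= N)%N.
  exact: leq_trans (size_poly _ _) sN.
rewrite /Fshift {1}/comp_poly (@horner_coef_wide _ N).
  apply: eq_bigr => i _; rewrite !coef_map /=.
  by rewrite rmorphXn rmorphD /= map_polyX map_polyC.
by rewrite size_map_polyC.
Qed.

Lemma bidegree_lt_Fshift f :
  f \in bidegree_lt n -> Fshift f \in bidegree_lt n.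
Proof.
case/andP=> sX sY; apply/andP; split.
  rewrite /Fshift size_comp_poly2 ?size_XaddC //.
  exact: leq_trans (size_poly _ _) sX.
apply/bigmax_leqP => -[j /= _] _; rewrite (FshiftE (leqnn _)) coef_sum.
apply: (leq_trans (size_sum _ _ _)); apply/bigmax_leqP => i _.
rewrite coefCM coef_map /= mulrC mul_polyC.
apply: (leq_trans (size_scale_leq _ _)).
rewrite size_comp_poly2 ?size_XsubC //.
exact: leq_trans (max_size_coefXY _ _) sY.
Qed.

Lemma bidegree_lt_swapXY f :
  f \in bidegree_lt n -> swapXY f \in bidegree_lt n.
Proof.
case/andP=> sX sY; apply/andP.
by rewrite sizeYE swapXYK -sizeYE.
Qed.

Lemma Fshift_swap_root f : root (Fshift f - swapXY f) ('X - h%:P).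
Proof.
rewrite /root hornerD hornerN /Fshift horner_comp hornerD hornerX hornerC subrK.
rewrite [swapXY]unlock (@horner_coef_wide _ (size f)) ?size_poly //.
rewrite (@horner_coef_wide _ (size f) (map_poly _ _)) ?size_poly //.
rewrite horner_sum subr_eq0; apply/eqP/eq_bigr => i _.
rewrite !coef_map /=.
by rewrite hornerM -rmorphXn /= hornerC.
Qed.

Lemma Rp_frac_stable (v : tensV F n) :
  exists u : tensV F n, tofrac (tpoly u) == Rp_frac v.
Proof.
have vV := valP v; have sV := bidegree_lt_Fshift vV.
have numV : Fshift v - swapXY v \in bidegree_lt n.
  by rewrite rpredB // bidegree_lt_swapXY.
have /factor_theorem[q num_q] := Fshift_swap_root v.
have qV : q \in bidegree_lt n.
  have [->|q0] := eqVneq q 0; first exact: rpred0.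
  have sw : swapXY ('X - ('X - h%:P)%:P) = - ('X - ('X + h%:P)%:P).
    rewrite rmorphB /= swapXY_X swapXY_polyC rmorphB /= map_polyX map_polyC /=.
    by rewrite polyCD !opprB addrA.
  move: numV; rewrite num_q => /andP[]; rewrite sizeYE rmorphM /= sw.
  rewrite mulrN size_polyN !size_Mmonic ?monicXsubC ?swapXY_eq0 //.
  rewrite !size_XsubC !addn2 /= => /ltnW qX /ltnW qY.
  by apply/andP; rewrite sizeYE.
have denomE : z1 - z2 + h%:P%:P = 'X - ('X - h%:P)%:P :> {poly {poly F}}.
  by rewrite polyCB opprB addrA addrAC.
have uV : Fshift v - (h%:P%:P *+ n) * q \in bidegree_lt n.
  rewrite rpredB // -!polyCMn mul_polyC.
  exact: (valP (h *+ n *: TensV qV : tensV F n)).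
exists (TensV uV) => /=; apply/eqP.
have D0 : tofrac ('X - ('X - h%:P)%:P : {poly {poly F}}) != 0.
  by rewrite tofrac_eq0 polyXsubC_eq0.
rewrite /Rp_frac -tofracB num_q denomE tofracB !tofracM; congr (_ - _).
by rewrite [tofrac q * _]mulrC -mulrA mulKf.
Qed.

(* By injectivity of tofrac the chosen value is unique (see RpE). *)
Definition Rp_fun (v : tensV F n) : tensV F n := xchoose (Rp_frac_stable v).

Lemma Rp_funE v : tofrac (tpoly (Rp_fun v)) = Rp_frac v.
Proof. exact/eqP/(xchooseP (Rp_frac_stable v)). Qed.

Fact Rp_fun_linear : linear Rp_fun.
Proof.
move=> c u v; apply/val_inj/eqP; rewrite -tofrac_eq; apply/eqP.
have sF : Fshift (c *: u + v) = c%:P%:P * Fshift u + Fshift v.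
  rewrite /Fshift /= raddfD /= -mul_polyC rmorphM /= map_polyC /= comp_polyC.
  by rewrite raddfD /= rmorphM /= comp_polyC.
have sS : swapXY (c *: u + v) = c%:P%:P * swapXY u + swapXY v.
  by rewrite /= raddfD /= -mul_polyC rmorphM /= swapXY_polyC map_polyC.
have -> : tofrac (tpoly (c *: Rp_fun u + Rp_fun v)) =
    tofrac c%:P%:P * Rp_frac u + Rp_frac v.
  rewrite -!Rp_funE -tofracM -tofracD.
  by rewrite mul_polyC.
have eF : tofrac (Fshift (c *: u + v)) =
    tofrac c%:P%:P * tofrac (Fshift u) + tofrac (Fshift v).
  by rewrite sF tofracD tofracM.
have eS : tofrac (swapXY (c *: u + v)) =
    tofrac c%:P%:P * tofrac (swapXY u) + tofrac (swapXY v).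
  by rewrite sS tofracD tofracM.
rewrite Rp_funE /Rp_frac eF eS.
exact: Rp_linear_subproof.
Qed.
HB.instance Definition _ :=
  GRing.isLinear.Build F (tensV F n) (tensV F n) _ Rp_fun Rp_fun_linear.

Definition Rp : 'End(tensV F n) := linfun Rp_fun.

Lemma RpE v : tofrac (tpoly (Rp v)) = Rp_frac v.
Proof. by rewrite lfunE /= Rp_funE. Qed.

End OperatorR.

(* T depends polynomially on h, and T(h) = I + r h + O(h^2): the O(h^2) term is
   h^2 times a polynomial in h with operator coefficients. When F is infinite
   this determines r. *)
Definition first_order_expansion (F : fieldType) (V : vectType F)
    (T : F -> 'End(V)) (r : 'End(V)) : Prop :=
  exists (d : nat) (Q : 'I_d -> 'End(V)), forall h : F,
    T h = \1%VF + h *: r + h ^+ 2 *: \sum_(k < d) h ^+ k *: Q k.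

Definition eta_sign (i j k : nat) : int :=
  if (i <= k < j)%N then 1 else if (j <= k < i)%N then -1 else 0.

Section MatrixRepresentation.
Variables (F : fieldType) (n : nat).

Definition zz (i j : nat) : {poly {poly F}} := z1 ^+ i * z2 ^+ j.

Lemma coef_zz i j a b : (zz i j)`_a`_b = ((a == i) && (b == j))%:R.
Proof.
rewrite /zz -rmorphXn /= coefMC coefXn; case: eqP => _ /=.
  by rewrite mul1r coefXn.
by rewrite mul0r coef0.
Qed.

Fact zz_bidegree (i j : 'I_n) : zz i j \in bidegree_lt n.
Proof.
apply/bidegree_ltP => a b ab; rewrite coef_zz.
case: eqP ab => [->|//]; case: eqP => [->|//].
by case/orP; rewrite leqNgt ltn_ord.
Qed.

(* Ordinals being 0-based, this is e_(i+1) (x) e_(j+1). *)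
Definition basisV (i j : 'I_n) : tensV F n := TensV (zz_bidegree i j).

(* Matrices act on column vectors: column q holds the coordinates of the image
   of the q-th basis vector. Pairs of indices are encoded as in tensmx. *)
Definition mx_of (T : 'End(tensV F n)) : 'M[F]_(n * n) :=
  \matrix_(p, q)
    let: (a, b) := mxtens_unindex p in
    let: (c, d) := mxtens_unindex q in
    (tpoly (T (basisV c d)))`_a`_b.

Lemma mx_ofE (T : 'End(tensV F n)) (c d : 'I_n) :
  T (basisV c d) =
  \sum_a \sum_b
    mx_of T (mxtens_index (a, b)) (mxtens_index (c, d)) *: basisV a b.
Proof.
have /bidegree_ltP T0 := valP (T (basisV c d)).
apply: val_inj; apply/polyP => i; apply/polyP => j.
under eq_bigr => a _ do under eq_bigr => b _ do
  rewrite mxE !mxtens_indexK /=.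
rewrite raddf_sum !coef_sum.
under eq_bigr => a _ do (rewrite raddf_sum !coef_sum;
  under eq_bigr => b _ do rewrite /= coefZ coefCM coef_zz).
have [ni|ni] := leqP n i.
  rewrite T0 ?ni // big1 // => a _; rewrite big1 // => b _.
  by rewrite gtn_eqF ?mulr0 // (leq_trans (ltn_ord a)).
have [nj|nj] := leqP n j.
  rewrite T0 ?nj ?orbT // big1 // => a _; rewrite big1 // => b _.
  by rewrite [j == _]gtn_eqF ?andbF ?mulr0 // (leq_trans (ltn_ord b)).
rewrite (bigD1 (Ordinal ni)) //= (bigD1 (Ordinal nj)) //= !eqxx mulr1.
rewrite !big1 ?addr0 // => [a ai | b bj].
  rewrite big1 // => b _; rewrite [i == _]eq_sym.
  by rewrite -val_eqE /= in ai; rewrite (negPf ai) mulr0.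
by rewrite -val_eqE /= eq_sym in bj; rewrite (negPf bj) andbF mulr0.
Qed.

(* The matrix unit E_ij, with 1-based indices; it is 0 when i or j is not
   between 1 and n. *)
Definition Emx (i j : nat) : 'M[F]_n :=
  \matrix_(a, b) ((a.+1 == i) && (b.+1 == j))%:R.

Definition wedge (A B : 'M[F]_n) : 'M[F]_(n * n) := A *t B - B *t A.

End MatrixRepresentation.

(* Main.v *)
Require Import Defs.
From HB Require Import structures.
From mathcomp Require Import all_boot all_order all_algebra.
From mathcomp Require Import zify ring.

(** On a monomial [z1^i z2^j] put [x = z1 + h] and [y = z2 - h].  Since
    [x - z2 = z1 - y = z1 - z2 + h], telescoping
    [x^i y^j - z1^j z2^i = (x^i - z2^i) y^j - z2^i (z1^j - y^j)]
    divides by this common factor and leaves an explicit polynomial in [z1],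
    [z2], [h], so the image of the monomial is the value at [h] of a polynomial
    with coefficients in [F[z1, z2]]; its value and derivative at [h = 0] give
    the first two terms of the expansion. *)

Set Implicit Arguments.
Unset Strict Implicit.
Unset Printing Implicit Defensive.

Import GRing.Theory.
Local Open Scope ring_scope.

(** * Exact division of a difference of two monomials *)

Definition quot_sum (A : comNzRingType) (x y u v : A) (i j : nat) : A :=
  y ^+ j * (\sum_(k < i) x ^+ k * v ^+ (i.-1 - k)) -
  v ^+ i * (\sum_(k < j) u ^+ k * y ^+ (j.-1 - k)).

(** The intended values are [u = z1], [v = z2], [x = z1 + h], [y = z2 - h]. The truncated
    predecessors [i.-1] and [j.-1] at 0 occur only inside empty sums. *)
Lemma quot_sumE (A : comNzRingType) (x y u v : A) i j : x - v = u - y ->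
  x ^+ i * y ^+ j - u ^+ j * v ^+ i = (u - y) * quot_sum x y u v i j.
Proof.
move=> e.
have Ei : x ^+ i - v ^+ i = (u - y) * \sum_(k < i) x ^+ k * v ^+ (i.-1 - k).
  rewrite -e -opprB subrXX -mulNr opprB; congr (_ * _).
  by apply: eq_bigr => k _; rewrite mulrC.
have Ej : u ^+ j - y ^+ j = (u - y) * \sum_(k < j) u ^+ k * y ^+ (j.-1 - k).
  rewrite -[LHS]opprB subrXX -mulNr opprB; congr (_ * _).
  by apply: eq_bigr => k _; rewrite mulrC.
rewrite /quot_sum mulrBr !(mulrCA (u - y)) -Ei -Ej; ring.
Qed.

Lemma rmorph_quot_sum (A B : comNzRingType) (f : {rmorphism A -> B})
    (x y u v : A) i j :
  f (quot_sum x y u v i j) = quot_sum (f x) (f y) (f u) (f v) i j.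
Proof.
rewrite /quot_sum rmorphB !rmorphM !rmorphXn !rmorph_sum.
by congr (_ * _ - _ * _); apply: eq_bigr => k _; rewrite rmorphM !rmorphXn.
Qed.

Lemma horner_quot_sum (A : comNzRingType) (x y u v : {poly A}) i j c :
  (quot_sum x y u v i j).[c] = quot_sum x.[c] y.[c] u.[c] v.[c] i j.
Proof. exact: (rmorph_quot_sum (horner_eval c)). Qed.

(** * The image of a monomial as a polynomial in [h] *)

Section DeformedMonomial.
Variables (A : comNzRingType) (n : nat) (a b : A) (i j : nat).

(** Here ['X] stands for [h], and [a], [b] for [z1], [z2]; the denominator [z1 - z2 + h] is already
    cancelled. *)
Definition Rpoly : {poly A} :=
  (a%:P + 'X) ^+ i * (b%:P - 'X) ^+ j -
  ('X * quot_sum (a%:P + 'X) (b%:P - 'X) a%:P b%:P i j) *+ n.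

Lemma horner_Rpoly c :
  Rpoly.[c] = (a + c) ^+ i * (b - c) ^+ j -
    (c * quot_sum (a + c) (b - c) a b i j) *+ n.
Proof.
rewrite /Rpoly hornerD hornerN hornerMn !hornerM horner_quot_sum.
by rewrite !horner_exp !hornerE.
Qed.

Lemma coef0_Rpoly : Rpoly`_0 = a ^+ i * b ^+ j.
Proof. by rewrite -horner_coef0 horner_Rpoly addr0 mul0r mul0rn !subr0. Qed.

(** The quotient carries a factor ['X], so only its value at [h = 0] enters, where [x = u = a] and
    [y = v = b]. The product of powers contributes its derivative at 0. *)
Lemma coef1_Rpoly :
  Rpoly`_1 = a ^+ i.-1 * b ^+ j *+ i - a ^+ i * b ^+ j.-1 *+ j -
    quot_sum a b a b i j *+ n.
Proof.
rewrite /Rpoly coefB coefMn coefXM /= -(horner_coef0 (quot_sum _ _ _ _ _ _)).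
rewrite horner_quot_sum !hornerE subr0; congr (_ - _).
have -> (p : {poly A}) : p`_1 = p^`().[0].
  by rewrite horner_coef0 coef_deriv mulr1n.
rewrite derivM !deriv_exp !derivE add0r sub0r mul1r mulN1r.
rewrite hornerD !hornerM !hornerMn !(hornerE, horner_exp) subr0.
by rewrite mulNrn mulrN !(mulrnAl, mulrnAr).
Qed.

End DeformedMonomial.

(** In this form each indicator matches the range of one of the two sums in [quot_sum]. *)
Lemma eta_signE i j k : eta_sign i j k = (k < j)%N%:Z - (k < i)%N%:Z.
Proof. by rewrite /eta_sign; case: (ltnP k j); case: (ltnP k i). Qed.

(** * Operators determined by their values on monomials, and the expansion in [h] *)

Section TensorSpace.
Variables (F : fieldType) (n : nat).
Local Notation V := (tensV F n).

Lemma tensV_coef_inj (u v : V) :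
  (forall a b : 'I_n, (val u)`_a`_b = (val v)`_a`_b) -> u = v.
Proof.
move=> uv; apply: val_inj; apply/polyP => i; apply/polyP => j.
have [/bidegree_ltP u0 /bidegree_ltP v0] := (valP u, valP v).
have [ni|ni] := leqP n i; first by rewrite u0 ?v0 ?ni.
have [nj|nj] := leqP n j; first by rewrite u0 ?v0 ?nj ?orbT.
exact: (uv (Ordinal ni) (Ordinal nj)).
Qed.

Lemma tensV_basisE (v : V) :
  v = \sum_(a < n) \sum_(b < n) (tpoly v)`_a`_b *: basisV F a b.
Proof.
apply: tensV_coef_inj => i j; rewrite raddf_sum !coef_sum.
under eq_bigr => a _ do (rewrite raddf_sum !coef_sum;
  under eq_bigr => b _ do
    rewrite /= coefZ coefCM coef_zz (val_eqE i a) (val_eqE j b)).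
rewrite (bigD1 i) //= (bigD1 j) //= !eqxx mulr1.
rewrite !big1 ?addr0 // => [a ai | b bj].
  by apply: big1 => b _; rewrite eq_sym (negPf ai) mulr0.
by rewrite [j == b]eq_sym (negPf bj) andbF mulr0.
Qed.

Lemma eq_on_basisV (S T : 'End(V)) :
  (forall i j : 'I_n, S (basisV F i j) = T (basisV F i j)) -> S = T.
Proof.
move=> ST; apply/lfunP => v; rewrite [v]tensV_basisE !linear_sum.
apply: eq_bigr => a _; rewrite !linear_sum; apply: eq_bigr => b _.
by rewrite !linearZ; congr (_ *: _); apply: ST.
Qed.

Definition extend_fun (w : 'I_n -> 'I_n -> V) (v : V) : V :=
  \sum_(a < n) \sum_(b < n) (tpoly v)`_a`_b *: w a b.

Fact extend_fun_linear w : linear (extend_fun w).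
Proof.
move=> c u v; rewrite /extend_fun scaler_sumr -big_split /=.
apply: eq_bigr => a _; rewrite scaler_sumr -big_split /=.
apply: eq_bigr => b _.
by rewrite !coefD coefZ coefCM scalerDl scalerA.
Qed.
HB.instance Definition _ w :=
  GRing.isLinear.Build F V V _ (extend_fun w) (extend_fun_linear w).

Definition extend w : 'End(V) := linfun (extend_fun w).

Lemma extendE w (i j : 'I_n) : extend w (basisV F i j) = w i j.
Proof.
rewrite lfunE /= /extend_fun (bigD1 i) //= (bigD1 j) //= coef_zz !eqxx scale1r.
rewrite !big1 ?addr0 // => [a ai | b bj].
  rewrite big1 // => b _; rewrite coef_zz (val_eqE a i) (negPf ai).
  by rewrite scale0r.
by rewrite coef_zz (val_eqE b j) (negPf bj) andbF scale0r.
Qed.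

(* The values at scalars of [RXY i j] below have bidegree less than [n], but its
   coefficients are not known to; truncation turns them into elements of [V]. *)
Definition truncV (p : {poly {poly F}}) : V :=
  \sum_(a < n) \sum_(b < n) p`_a`_b *: basisV F a b.

Lemma tpolyK (v : V) : truncV (tpoly v) = v.
Proof. exact: esym (tensV_basisE v). Qed.

Lemma truncVK p : p \in bidegree_lt n -> tpoly (truncV p) = p.
Proof. by move=> pV; rewrite (tpolyK (TensV pV)). Qed.

Fact truncV_zmod_morphism : zmod_morphism truncV.
Proof.
move=> p q; rewrite /truncV -sumrB; apply: eq_bigr => a _.
by rewrite -sumrB; apply: eq_bigr => b _; rewrite !coefB scalerBl.
Qed.
HB.instance Definition _ :=
  GRing.isZmodMorphism.Build {poly {poly F}} V truncV truncV_zmod_morphism.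

Lemma truncVZ p c : truncV (p * c%:P%:P) = c *: truncV p.
Proof.
rewrite /truncV scaler_sumr; apply: eq_bigr => a _.
rewrite scaler_sumr; apply: eq_bigr => b _.
by rewrite !coefMC scalerA mulrC.
Qed.

Lemma zz_bidegree_lt i j : (i < n)%N -> (j < n)%N -> zz F i j \in bidegree_lt n.
Proof. by move=> ni nj; apply: (zz_bidegree F (Ordinal ni) (Ordinal nj)). Qed.

(** The outermost variable is [h]; its coefficients are polynomials in [z1] and [z2]. *)
Definition RXY (i j : nat) : {poly {poly {poly F}}} :=
  Rpoly n ('X : {poly {poly F}}) (polyC ('X : {poly F})) i j.

Lemma Rp_horner h (i j : 'I_n) :
  tpoly (Rp n h (basisV F i j)) = (RXY i j).[h%:P%:P].
Proof.
apply/eqP; rewrite -tofrac_eq RpE /Rp_frac; apply/eqP.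
set x : {poly {poly F}} := 'X + h%:P%:P.
set y : {poly {poly F}} := 'X%:P - h%:P%:P.
have eF : Fshift h (basisV F i j) = x ^+ i * y ^+ j.
  rewrite /Fshift /= /zz !rmorphM !rmorphXn /= map_polyX map_polyC /=.
  by rewrite comp_polyX comp_polyC comp_polyX rmorphB.
have eS : swapXY (basisV F i j) = 'X ^+ j * 'X%:P ^+ i.
  by rewrite /= /zz rmorphM !rmorphXn /= swapXY_X swapXY_Y mulrC.
(* ['X - y] is the denominator [z1 - z2 + h]: monic in [z1], it is nonzero for every [h] and can be
   cancelled. *)
have D0 : tofrac ('X - y) != 0.
  by rewrite tofrac_eq0 /y -rmorphB /= polyXsubC_eq0.
rewrite -tofracB eF eS quot_sumE /x /y; last by ring.
rewrite -/x -/y.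
have -> : 'X - 'X%:P + h%:P%:P = 'X - y by rewrite /y; ring.
rewrite [tofrac (('X - y) * _)]tofracM mulrA divfK //.
by rewrite -tofracM -tofracB; congr tofrac; rewrite /RXY horner_Rpoly mulrnAl.
Qed.

Definition rpoly (i j : nat) : {poly {poly F}} :=
  (\sum_(k < n) zz F k (i + j - k - 1) *~ eta_sign i j k) *+ n
    + zz F i.-1 j *+ i - zz F i j.-1 *+ j.

(** A nonzero sign puts [k] between the smaller of [i], [j] and the larger minus 1, an interval that
    the reflection sending [k] to [i + j - k - 1] preserves. Elsewhere that exponent may exceed the
    bound, but the sign is 0. *)
Lemma rpoly_bidegree_lt (i j : 'I_n) : rpoly i j \in bidegree_lt n.
Proof.
have [hi hj] := (ltn_ord i, ltn_ord j).
rewrite /rpoly rpredB ?rpredD ?rpredMn ?rpred_sum ?zz_bidegree_lt //; try lia.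
move=> k _; rewrite /eta_sign.
case: ifP => [kij|_]; first by rewrite rpredMz ?zz_bidegree_lt //; lia.
case: ifP => [kij|_]; last by rewrite mulr0z rpred0.
by rewrite rpredMz ?zz_bidegree_lt //; lia.
Qed.

(** At [h = 0] both sums run over the same monomials [zz F k (i + j - k - 1)], one for [k < i] and
    the other for [k < j]. Extended by zero to [k < n], they differ by minus the sign. *)
Lemma quot_sum_zz (i j : 'I_n) :
  quot_sum 'X 'X%:P 'X 'X%:P i j =
  - \sum_(k < n) zz F k (i + j - k - 1) *~ eta_sign i j k.
Proof.
have sumE (m l : 'I_n) :
    'X%:P ^+ l * (\sum_(k < m) 'X ^+ k * 'X%:P ^+ (m.-1 - k)) =
    \sum_(k < n) zz F k (m + l - k - 1) *~ (k < m)%N%:Z.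
  rewrite (bigID (fun k : 'I_n => k < m)%N) /=.
  rewrite [X in _ + X]big1 ?addr0 => [|k /negPf-> //].
  rewrite mulr_sumr (big_ord_narrow (ltnW (ltn_ord m))) /=.
  apply: eq_bigr => k _; rewrite ltn_ord /zz mulrCA -exprD; congr (_ * _ ^+ _).
  by have := ltn_ord k; lia.
rewrite /quot_sum !sumE -sumrB -sumrN; apply: eq_bigr => k _.
by rewrite eta_signE -mulrNz opprB mulrzBr [(j + i)%N]addnC.
Qed.

Lemma coef1_RXY (i j : 'I_n) : (RXY i j)`_1 = rpoly i j.
Proof. by rewrite coef1_Rpoly quot_sum_zz mulNrn opprK addrC addrA. Qed.

Definition r_p : 'End(V) := extend (fun i j => truncV (rpoly i j)).

Lemma r_p_basisV (i j : 'I_n) : tpoly (r_p (basisV F i j)) = rpoly i j.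
Proof. by rewrite extendE truncVK ?rpoly_bidegree_lt. Qed.

Lemma Rp_basisV h (i j : 'I_n) d : (size (RXY i j) <= d)%N ->
  Rp n h (basisV F i j) = \sum_(k < d) h ^+ k *: truncV (RXY i j)`_k.
Proof.
move=> sd; rewrite -[LHS]tpolyK Rp_horner (horner_coef_wide _ sd) raddf_sum.
by apply: eq_bigr => k _; rewrite -!polyC_exp -truncVZ.
Qed.

Lemma Rp_expansion : first_order_expansion (Rp n) r_p.
Proof.
(* One bound for all monomials. Using [d.+2] below allows the coefficients 0 and 1 to be split off
   whatever [d] is, which leaves the shifted index [k.+2]. *)
pose d := (\max_(i < n) \max_(j < n) size (RXY i j))%N.
exists d, (fun k => extend (fun i j => truncV (RXY i j)`_k.+2)) => h.
apply: eq_on_basisV => i j.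
have sd : (size (RXY i j) <= d.+2)%N.
  apply: leq_trans (leqW (leqnSn d)).
  apply: leq_trans (leq_bigmax (F := fun i : 'I_n => \max_(j < n) _)%N i).
  exact: (leq_bigmax (F := fun j : 'I_n => size (RXY i j)) j).
rewrite (Rp_basisV h sd) !big_ord_recl /= expr0 expr1 scale1r.
rewrite coef0_Rpoly (tpolyK (basisV F i j)) coef1_RXY.
rewrite !add_lfunE !scale_lfunE id_lfunE extendE addrA.
rewrite sum_lfunE scaler_sumr; congr (_ + _); apply: eq_bigr => k _.
by rewrite scale_lfunE extendE scalerA -exprD.
Qed.

End TensorSpace.

(** * Entries of the matrix of the linear term *)

Lemma wedge_Emx (F : fieldType) n (k i l j : nat) (a b c d : 'I_n) :
  wedge (Emx F n k i) (Emx F n l j) (mxtens_index (a, b)) (mxtens_index (c, d)) =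
  ((a.+1 == k) && (c.+1 == i))%:R * ((b.+1 == l) && (d.+1 == j))%:R -
  ((a.+1 == l) && (c.+1 == j))%:R * ((b.+1 == k) && (d.+1 == i))%:R.
Proof. by rewrite /wedge !mxE !mxtens_indexK. Qed.

Lemma sum_nat_delta (A : nzRingType) (m n l : nat) (f : nat -> A) :
  \sum_(m <= k < n) (l == k)%:R * f k = (m <= l < n)%N%:R * f l.
Proof.
under eq_bigr => k _ do rewrite mulr_natl mulrb eq_sym.
by rewrite -big_mkcond big_nat1_eq mulr_natl mulrb.
Qed.

(** The deltas force [i = c + 1], [j = d + 1], [k = a + 1]. What survives is the range of [k] and
    the remaining row condition [b + 1 = c + d - a]. *)
Lemma sum_Emx_tens (A : nzRingType) n (a b c d : 'I_n) :
  \sum_(1 <= i < n.+1) \sum_(i.+1 <= j < n.+1) \sum_(i <= k < j)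
    ((a.+1 == k) && (c.+1 == i))%:R *
    ((b.+1 == i + j - k - 1)%N && (d.+1 == j))%:R =
  ((c <= a < d) && (a + b + 1 == c + d))%N%:R :> A.
Proof.
have termE (i j k : nat) :
    ((a.+1 == k) && (c.+1 == i))%:R *
    ((b.+1 == i + j - k - 1)%N && (d.+1 == j))%:R =
    (c.+1 == i)%:R * ((d.+1 == j)%:R *
      ((a.+1 == k)%:R * (b.+1 == i + j - k - 1)%N%:R)) :> A.
  by rewrite -!natrM !mulnb; congr (_%:R); do 4 case: (_ == _).
under eq_bigr => i _ do (under eq_bigr => j _ do
  (under eq_bigr => k _ do rewrite termE;
   rewrite -!mulr_sumr sum_nat_delta); rewrite -mulr_sumr sum_nat_delta).
rewrite sum_nat_delta -!natrM !mulnb; congr (_%:R).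
by move: (ltn_ord c) (ltn_ord d); lia.
Qed.

(** Only [k = a] contributes. When [a + b + 1 = c + d], the negative range [d <= a < c] is
    equivalent to [d <= b < c], so the second indicator is the first with the tensor factors
    exchanged, as in a wedge. *)
Lemma coef_sum_eta (F : fieldType) n (a b c d : 'I_n) :
  (\sum_(k < n) zz F k (c + d - k - 1) *~ eta_sign c d k)`_a`_b =
  ((c <= a < d) && (a + b + 1 == c + d))%N%:R -
  ((d <= b < c) && (b + a + 1 == d + c))%N%:R :> F.
Proof.
have -> : (\sum_(k < n) zz F k (c + d - k - 1) *~ eta_sign c d k)`_a`_b =
    (zz F a (c + d - a - 1))`_a`_b *~ eta_sign c d a.
  rewrite !coef_sum (bigD1 a) //= big1 ?addr0 ?coefMrz // => k ka.
  by rewrite !coefMrz coef_zz eq_sym (val_eqE k a) (negPf ka) mul0rz.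
rewrite coef_zz eqxx eta_signE.
have -> : ((c <= a < d) && (a + b + 1 == c + d))%N =
    [&& a < d, ~~ (a < c) & (b == c + d - a - 1 :> nat)]%N by lia.
have -> : ((d <= b < c) && (b + a + 1 == d + c))%N =
    [&& a < c, ~~ (a < d) & (b == c + d - a - 1 :> nat)]%N by lia.
case: (a < d)%N; case: (a < c)%N; case: (_ == _) => /=;
  by rewrite ?subrr ?subr0 ?sub0r ?mulrNz ?mul0rz ?mulr0z ?oppr0.
Qed.

Lemma mx_of_r_p (F : fieldType) n :
  mx_of (r_p F n) =
    (\sum_(1 <= i < n.+1) \sum_(i.+1 <= j < n.+1) \sum_(i <= k < j)
       wedge (Emx F n k i) (Emx F n (i + j - k - 1) j)) *+ n
    + \sum_(1 <= i < n.+1) \sum_(1 <= j < n.+1)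
        wedge (Emx F n j.-1 j) (Emx F n i i) *+ j.-1.
Proof.
apply/matrixP => p q; rewrite -[p]mxtens_unindexK -[q]mxtens_unindexK.
case: (mxtens_unindex p) => a b; case: (mxtens_unindex q) => c d.
rewrite mxE !mxtens_indexK r_p_basisV /rpoly.
rewrite [RHS]mxE mulmxnE !summxE.
(* Commuting the factors in the second half of the wedge gives it the shape of [sum_Emx_tens] with
   [a], [b] and [c], [d] swapped. *)
under [in X in _ = X *+ _ + _]eq_bigr => i _ do (rewrite summxE;
  under eq_bigr => j _ do (rewrite summxE;
  under eq_bigr => k _ do rewrite wedge_Emx [X in _ - X]mulrC;
  rewrite sumrB); rewrite sumrB).
rewrite sumrB !sum_Emx_tens -coef_sum_eta.
rewrite !coefB !coefD !coefMn -addrA; congr (_ + _).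
(* The column deltas are pulled out so that both sums collapse: to [i = d + 1], [j = c + 1] in the
   first half, and to [i = c + 1], [j = d + 1] in the second. *)
have termE (i j : nat) :
    (((a.+1 == j.-1) && (c.+1 == j))%:R * ((b.+1 == i) && (d.+1 == i))%:R -
     ((a.+1 == i) && (c.+1 == i))%:R * ((b.+1 == j.-1) && (d.+1 == j))%:R)
      *+ j.-1 =
    (d.+1 == i)%:R * ((c.+1 == j)%:R *
      (((a.+1 == j.-1) && (b.+1 == i))%:R *+ j.-1)) -
    (c.+1 == i)%:R * ((d.+1 == j)%:R *
      (((a.+1 == i) && (b.+1 == j.-1))%:R *+ j.-1)) :> F.
  rewrite mulrnBl; congr (_ - _); do 4 case: (_ == _);
  by rewrite /= ?mulr0n ?mulr1n ?mul0r ?mulr0 ?mul1r ?mulr1 ?mul0r ?mul0rn.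
under [RHS]eq_bigr => i _ do (rewrite summxE;
  under eq_bigr => j _ do rewrite mulmxnE wedge_Emx termE;
  rewrite sumrB -!mulr_sumr !sum_nat_delta).
rewrite sumrB !sum_nat_delta !coef_zz !ltnS !ltn_ord !mul1r !eqSS /=.
(* The conditions [a.+1 == c] and [a == c.-1] disagree only for [c = 0], where the multiplicity [c]
   kills the term; likewise for [d]. *)
by case: c {termE} => -[|c] hc; case: d => -[|d] hd; rewrite /= ?mulr0n.
Qed.

Theorem theorem1p6 (F : closedFieldType) (charF : [pchar F] =i pred0)
    (n : nat) (n_gt0 : (0 < n)%N) :
  exists r : 'End(tensV F n),
  [/\ first_order_expansion (Rp n) r,
      forall i j : 'I_n,
        tpoly (r (basisV F i j)) =
          (\sum_(k < n) zz F k (i + j - k - 1) *~ eta_sign i j k) *+ n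
          + zz F i.-1 j *+ i - zz F i j.-1 *+ j
    & mx_of r =
        (\sum_(1 <= i < n.+1) \sum_(i.+1 <= j < n.+1) \sum_(i <= k < j)
           wedge (Emx F n k i) (Emx F n (i + j - k - 1) j)) *+ n
        + \sum_(1 <= i < n.+1) \sum_(1 <= j < n.+1)
            wedge (Emx F n j.-1 j) (Emx F n i i) *+ j.-1].
Proof.
exists (r_p F n).
by split; [exact: Rp_expansion | exact: r_p_basisV | exact: mx_of_r_p].
Qed.
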